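(* Let $M$ be a monoidal category and $C$ an $M$-actegory. The functors $R:C\to\mathit{Tamb}_{C,M}$, $x\mapsto R_x$, $f\mapsto R_f$, and $L:C^{op}\to\mathit{Tamb}_{M,C}$, $x\mapsto L_x$, $f\mapsto L_f$, are fully faithful.
   Context: $(M,\otimes,I,\lambda,a)$ is a monoidal category; an $M$-actegory is a category $C$ with a functor $\odot:M\times C\to C$ and coherent natural isomorphisms $\lambda_x:I\odot x\to x$, $a_{m,n,x}:(m\otimes n)\odot x\to m\odot(n\odot x)$; $M$ is an $M$-actegory via $\otimes$. Composition is diagrammatic. For $M$-actegories $C,D$, $\mathit{Tamb}_{C,D}$ is the category of functors $P:C^{op}\times D\to\mathrm{Set}$ with strength maps $P(c,d)\to P(m\odot c,m\odot d)$ natural in $c,d$, (di)natural in $m$, compatible with unitors/associators; morphisms are strength-preserving natural transformations. $R_x\in\mathit{Tamb}_{C,M}$ is $(c,n)\mapsto C(c,n\odot x)$ with strength $h\mapsto(m\odot h);a^{-1}_{m,n,x}$; $L_x\in\mathit{Tamb}_{M,C}$ is $(n,c)\mapsto C(n\odot x,c)$ with strength $h\mapsto a_{m,n,x};(m\odot h)$. For $f:x\to y$, $R_f:R_x\Rightarrow R_y$ postcomposes with $n\odot f$ and $L_f:L_y\Rightarrow L_x$ precomposes with $n\odot f$. *)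

(* Defs.v *)
(* a small hand-rolled category-theory layer (no category theory
   library is installed).  Composition is DIAGRAMMATIC: f ;; g means "f then g". *)

Set Implicit Arguments.
Unset Strict Implicit.

Record Category := {
  ob : Type;
  hom : ob -> ob -> Type;
  idm : forall a, hom a a;
  comp : forall a b c, hom a b -> hom b c -> hom a c;
  comp_id_l : forall a b (f : hom a b), comp (idm a) f = f;
  comp_id_r : forall a b (f : hom a b), comp f (idm b) = f;
  comp_assoc : forall a b c d (f : hom a b) (g : hom b c) (h : hom c d),
      comp (comp f g) h = comp f (comp g h)
}.
Arguments hom {c0} _ _.
Arguments idm {c0} _.
Arguments comp {c0 a b c} _ _.
Notation "f ;; g" := (comp f g) (at level 40, left associativity).

Record Monoidal (M : Category) := {
  tens : ob M -> ob M -> ob M;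
  tens_hom : forall m m' n n', hom m m' -> hom n n' -> hom (tens m n) (tens m' n');
  tens_id : forall m n, tens_hom (idm m) (idm n) = idm (tens m n);
  tens_comp : forall m m' m'' n n' n'' (u : hom m m') (u' : hom m' m'')
      (v : hom n n') (v' : hom n' n''),
      tens_hom (u ;; u') (v ;; v') = tens_hom u v ;; tens_hom u' v';
  unit_ob : ob M;
  lamM : forall m, hom (tens unit_ob m) m;
  lamM_inv : forall m, hom m (tens unit_ob m);
  lamM_iso1 : forall m, lamM m ;; lamM_inv m = idm _;
  lamM_iso2 : forall m, lamM_inv m ;; lamM m = idm _;
  lamM_nat : forall m m' (u : hom m m'), tens_hom (idm unit_ob) u ;; lamM m' = lamM m ;; u;
  rhoM : forall m, hom (tens m unit_ob) m;
  rhoM_inv : forall m, hom m (tens m unit_ob);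
  rhoM_iso1 : forall m, rhoM m ;; rhoM_inv m = idm _;
  rhoM_iso2 : forall m, rhoM_inv m ;; rhoM m = idm _;
  rhoM_nat : forall m m' (u : hom m m'), tens_hom u (idm unit_ob) ;; rhoM m' = rhoM m ;; u;
  alphaM : forall m n p, hom (tens (tens m n) p) (tens m (tens n p));
  alphaM_inv : forall m n p, hom (tens m (tens n p)) (tens (tens m n) p);
  alphaM_iso1 : forall m n p, alphaM m n p ;; alphaM_inv m n p = idm _;
  alphaM_iso2 : forall m n p, alphaM_inv m n p ;; alphaM m n p = idm _;
  alphaM_nat : forall m m' n n' p p' (u : hom m m') (v : hom n n') (w : hom p p'),
      tens_hom (tens_hom u v) w ;; alphaM m' n' p' = alphaM m n p ;; tens_hom u (tens_hom v w);
  pentagonM : forall m n p q,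
      alphaM (tens m n) p q ;; alphaM m n (tens p q)
      = tens_hom (alphaM m n p) (idm q) ;; alphaM m (tens n p) q ;; tens_hom (idm m) (alphaM n p q);
  triangleM : forall m n,
      alphaM m unit_ob n ;; tens_hom (idm m) (lamM n) = tens_hom (rhoM m) (idm n)
}.
Arguments tens {M} _ _ _.
Arguments tens_hom {M} _ {m m' n n'} _ _.
Arguments unit_ob {M} _.
Arguments lamM {M} _ _.
Arguments rhoM {M} _ _.
Arguments alphaM {M} _ _ _ _.
Arguments alphaM_inv {M} _ _ _ _.

Record ActData (M : Category) (MM : Monoidal M) (C : Category) := {
  act : ob M -> ob C -> ob C;
  act_hom : forall m m' c c', hom m m' -> hom c c' -> hom (act m c) (act m' c');
  lam : forall c, hom (act (unit_ob MM) c) c;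
  lam_inv : forall c, hom c (act (unit_ob MM) c);
  asc : forall m n c, hom (act (tens MM m n) c) (act m (act n c));
  asc_inv : forall m n c, hom (act m (act n c)) (act (tens MM m n) c)
}.
Arguments act {M MM C} _ _ _.
Arguments act_hom {M MM C} _ {m m' c c'} _ _.
Arguments lam {M MM C} _ _.
Arguments lam_inv {M MM C} _ _.
Arguments asc {M MM C} _ _ _ _.
Arguments asc_inv {M MM C} _ _ _ _.

Record IsActegory (M : Category) (MM : Monoidal M) (C : Category) (A : ActData MM C) : Prop := {
  act_id : forall m c, act_hom A (idm m) (idm c) = idm (act A m c);
  act_comp : forall m m' m'' c c' c'' (u : hom m m') (u' : hom m' m'')
      (f : hom c c') (f' : hom c' c''),
      act_hom A (u ;; u') (f ;; f') = act_hom A u f ;; act_hom A u' f';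
  lam_iso1 : forall c, lam A c ;; lam_inv A c = idm _;
  lam_iso2 : forall c, lam_inv A c ;; lam A c = idm _;
  lam_nat : forall c c' (f : hom c c'),
      act_hom A (idm (unit_ob MM)) f ;; lam A c' = lam A c ;; f;
  asc_iso1 : forall m n c, asc A m n c ;; asc_inv A m n c = idm _;
  asc_iso2 : forall m n c, asc_inv A m n c ;; asc A m n c = idm _;
  asc_nat : forall m m' n n' c c' (u : hom m m') (v : hom n n') (f : hom c c'),
      act_hom A (tens_hom MM u v) f ;; asc A m' n' c'
      = asc A m n c ;; act_hom A u (act_hom A v f);
  act_pentagon : forall m n p x,
      asc A (tens MM m n) p x ;; asc A m n (act A p x)
      = act_hom A (alphaM MM m n p) (idm x) ;; asc A m (tens MM n p) x
        ;; act_hom A (idm m) (asc A n p x);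
  act_unit_l : forall m x,
      asc A (unit_ob MM) m x ;; lam A (act A m x) = act_hom A (lamM MM m) (idm x);
  act_unit_r : forall m x,
      asc A m (unit_ob MM) x ;; act_hom A (idm m) (lam A x) = act_hom A (rhoM MM m) (idm x)
}.

Record Actegory (M : Category) (MM : Monoidal M) (C : Category) := {
  adata :> ActData MM C;
  adata_ax : IsActegory adata
}.

Definition selfAct (M : Category) (MM : Monoidal M) : ActData MM M := {|
  act := tens MM;
  act_hom := fun m m' n n' u v => tens_hom MM u v;
  lam := lamM MM;
  lam_inv := lamM_inv MM;
  asc := alphaM MM;
  asc_inv := alphaM_inv MM
|}.

Record TambData (M : Category) (MM : Monoidal M) (C D : Category)
    (AC : ActData MM C) (AD : ActData MM D) := {
  pob : ob C -> ob D -> Type;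
  dimap : forall c c' d d', hom c' c -> hom d d' -> pob c d -> pob c' d';
  st : forall m c d, pob c d -> pob (act AC m c) (act AD m d)
}.
Arguments pob {M MM C D AC AD} _ _ _.
Arguments dimap {M MM C D AC AD} _ {c c' d d'} _ _ _.
Arguments st {M MM C D AC AD} _ _ {c d} _.

Record IsTambara (M : Category) (MM : Monoidal M) (C D : Category)
    (AC : ActData MM C) (AD : ActData MM D) (P : TambData AC AD) : Prop := {
  dimap_id : forall c d (p : pob P c d), dimap P (idm c) (idm d) p = p;
  dimap_comp : forall c c' c'' d d' d'' (f : hom c' c) (f' : hom c'' c')
      (g : hom d d') (g' : hom d' d'') (p : pob P c d),
      dimap P (f' ;; f) (g ;; g') p = dimap P f' g' (dimap P f g p);
  st_nat : forall m c c' d d' (f : hom c' c) (g : hom d d') (p : pob P c d),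
      st P m (dimap P f g p) = dimap P (act_hom AC (idm m) f) (act_hom AD (idm m) g) (st P m p);
  st_dinat : forall m m' (u : hom m m') c d (p : pob P c d),
      dimap P (idm (act AC m c)) (act_hom AD u (idm d)) (st P m p)
      = dimap P (act_hom AC u (idm c)) (idm (act AD m' d)) (st P m' p);
  st_unit : forall c d (p : pob P c d),
      dimap P (lam_inv AC c) (lam AD d) (st P (unit_ob MM) p) = p;
  st_assoc : forall m n c d (p : pob P c d),
      st P (tens MM m n) p = dimap P (asc AC m n c) (asc_inv AD m n d) (st P m (st P n p))
}.

Definition IsTambHom (M : Category) (MM : Monoidal M) (C D : Category)
    (AC : ActData MM C) (AD : ActData MM D) (P Q : TambData AC AD)
    (th : forall c d, pob P c d -> pob Q c d) : Prop :=
  (forall c c' d d' (f : hom c' c) (g : hom d d') (p : pob P c d),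
      th c' d' (dimap P f g p) = dimap Q f g (th c d p)) /\
  (forall m c d (p : pob P c d), th _ _ (st P m p) = st Q m (th c d p)).

Section RL.
Variables (M : Category) (MM : Monoidal M) (C : Category) (A : ActData MM C).

Definition Rx (x : ob C) : TambData A (selfAct MM) :=
  @Build_TambData M MM C M A (selfAct MM)
    (fun c n => hom c (act A n x))
    (fun c c' n n' f g h => f ;; h ;; act_hom A g (idm x))
    (fun m c n h => act_hom A (idm m) h ;; asc_inv A m n x).

Definition Rf (x y : ob C) (f : hom x y) :
    forall c n, pob (Rx x) c n -> pob (Rx y) c n :=
  fun c n h => h ;; act_hom A (idm n) f.

Definition Lx (x : ob C) : TambData (selfAct MM) A :=
  @Build_TambData M MM M C (selfAct MM) A
    (fun n c => hom (act A n x) c)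
    (fun n n' c c' g f h => act_hom A g (idm x) ;; h ;; f)
    (fun m n c h => asc A m n x ;; act_hom A (idm m) h).

Definition Lf (x y : ob C) (f : hom x y) :
    forall n c, pob (Lx y) n c -> pob (Lx x) n c :=
  fun n c h => act_hom A (idm n) f ;; h.
End RL.
Arguments IsTambHom {M MM C D AC AD} P Q th.
Arguments IsTambara {M MM C D AC AD} P.
Arguments Rx {M MM C} A x.
Arguments Lx {M MM C} A x.
Arguments Rf {M MM C} A {x y} f {c n} _.
Arguments Lf {M MM C} A {x y} f {n c} _.

(* Main.v *)
Require Import Defs.

(* Both functors are Yoneda embeddings in disguise.  A strength-preserving
   θ : R_x ⇒ R_y is determined by θ(λ_x⁻¹) ∈ R_y(x, I): naturality gives
   θ(h) = h ; θ(id_{n⊙x}), and id_{n⊙x} is the image of λ_x⁻¹ under the strength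
   at n followed by ρ_n (right unit coherence of the action), so θ = R_f with
   f = θ(λ_x⁻¹) ; λ_y.  Faithfulness is evaluation at λ_x⁻¹, since I ⊙ - is
   isomorphic to the identity via λ.  Dually L is generated by λ_y ∈ L_y(I, y).
   That R_x and L_x are Tambara modules is the pentagon and unit coherence of
   the action, transported along the associator. *)

Section CategoryFacts.
Context {X : Category}.

Lemma comp_cancel_l {a b c : ob X} (i : hom a b) (j : hom b a) (k : hom a c) :
  i ;; j = idm a -> i ;; (j ;; k) = k.
Proof. intro E. rewrite <- comp_assoc, E, comp_id_l. reflexivity. Qed.

Lemma split_epi_cancel {a b c : ob X} (e : hom a b) (s : hom b a) (f g : hom b c) :
  s ;; e = idm b -> e ;; f = e ;; g -> f = g.
Proof.
  intros E Efg. rewrite <- (comp_cancel_l s e f E), <- (comp_cancel_l s e g E), Efg.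
  reflexivity.
Qed.

Lemma split_mono_cancel {a b c : ob X} (m : hom b a) (r : hom a b) (f g : hom c b) :
  m ;; r = idm b -> f ;; m = g ;; m -> f = g.
Proof.
  intros E Efg. rewrite <- (comp_id_r f), <- (comp_id_r g), <- E, <- !comp_assoc, Efg.
  reflexivity.
Qed.

End CategoryFacts.

Section ActegoryFacts.
Context {M : Category} {MM : Monoidal M} {C : Category} {A : ActData MM C}.
Hypothesis HA : IsActegory A.

Lemma act_hom_comp_r {m : ob M} {c c' c'' : ob C} (f : hom c c') (g : hom c' c'') :
  act_hom A (idm m) (f ;; g) = act_hom A (idm m) f ;; act_hom A (idm m) g.
Proof. rewrite <- (act_comp HA), comp_id_l. reflexivity. Qed.

Lemma act_hom_comp_l {m m' m'' : ob M} {c : ob C} (u : hom m m') (u' : hom m' m'') :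
  act_hom A (u ;; u') (idm c) = act_hom A u (idm c) ;; act_hom A u' (idm c).
Proof. rewrite <- (act_comp HA), comp_id_l. reflexivity. Qed.

Lemma act_hom_interchange {m m' : ob M} {c c' : ob C} (u : hom m m') (f : hom c c') :
  act_hom A u (idm c) ;; act_hom A (idm m') f = act_hom A (idm m) f ;; act_hom A u (idm c').
Proof. rewrite <- !(act_comp HA), !comp_id_l, !comp_id_r. reflexivity. Qed.

Lemma asc_inv_nat {m m' n n' : ob M} {c c' : ob C}
    (u : hom m m') (v : hom n n') (f : hom c c') :
  act_hom A u (act_hom A v f) ;; asc_inv A m' n' c'
  = asc_inv A m n c ;; act_hom A (tens_hom MM u v) f.
Proof.
  apply (split_epi_cancel (asc A m n c) (asc_inv A m n c)); [exact (asc_iso2 HA _ _ _)|].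
  rewrite (comp_cancel_l _ _ _ (asc_iso1 HA _ _ _)), <- comp_assoc, <- (asc_nat HA),
    comp_assoc, (asc_iso1 HA), comp_id_r.
  reflexivity.
Qed.

Lemma asc_inv_nat_l {m m' : ob M} (u : hom m m') (n : ob M) (c : ob C) :
  act_hom A u (idm (act A n c)) ;; asc_inv A m' n c
  = asc_inv A m n c ;; act_hom A (tens_hom MM u (idm n)) (idm c).
Proof. rewrite <- asc_inv_nat, (act_id HA). reflexivity. Qed.

Lemma asc_inv_unit_l (n : ob M) (x : ob C) :
  asc_inv A (unit_ob MM) n x ;; act_hom A (lamM MM n) (idm x) = lam A (act A n x).
Proof. rewrite <- (act_unit_l HA), (comp_cancel_l _ _ _ (asc_iso2 HA _ _ _)). reflexivity. Qed.

Lemma asc_inv_unit_r (n : ob M) (x : ob C) :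
  asc_inv A n (unit_ob MM) x ;; act_hom A (rhoM MM n) (idm x) = act_hom A (idm n) (lam A x).
Proof. rewrite <- (act_unit_r HA), (comp_cancel_l _ _ _ (asc_iso2 HA _ _ _)). reflexivity. Qed.

Lemma asc_nat_l {m m' : ob M} (u : hom m m') (n : ob M) (c : ob C) :
  act_hom A (tens_hom MM u (idm n)) (idm c) ;; asc A m' n c
  = asc A m n c ;; act_hom A u (idm (act A n c)).
Proof. rewrite (asc_nat HA), (act_id HA). reflexivity. Qed.

Lemma asc_unit_r (n : ob M) (x : ob C) :
  asc A n (unit_ob MM) x = act_hom A (rhoM MM n) (idm x) ;; act_hom A (idm n) (lam_inv A x).
Proof.
  rewrite <- (act_unit_r HA), comp_assoc, <- act_hom_comp_r, (lam_iso1 HA), (act_id HA),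
    comp_id_r.
  reflexivity.
Qed.

Lemma asc_inv_pentagon (m n p : ob M) (x : ob C) :
  act_hom A (idm m) (asc_inv A n p x) ;; (asc_inv A m (tens MM n p) x
    ;; act_hom A (alphaM_inv MM m n p) (idm x))
  = asc_inv A m n (act A p x) ;; asc_inv A (tens MM m n) p x.
Proof.
  set (P := asc A (tens MM m n) p x ;; asc A m n (act A p x)).
  assert (HP : P ;; (asc_inv A m n (act A p x) ;; asc_inv A (tens MM m n) p x) = idm _).
  { unfold P. rewrite comp_assoc, (comp_cancel_l _ _ _ (asc_iso1 HA _ _ _)), (asc_iso1 HA).
    reflexivity. }
  assert (Halpha : act_hom A (alphaM_inv MM m n p) (idm x)
                   ;; act_hom A (alphaM MM m n p) (idm x) = idm _).
  { rewrite <- act_hom_comp_l, (alphaM_iso2 MM), (act_id HA). reflexivity. }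
  assert (Hasc : act_hom A (idm m) (asc_inv A n p x) ;; act_hom A (idm m) (asc A n p x) = idm _).
  { rewrite <- act_hom_comp_r, (asc_iso2 HA), (act_id HA). reflexivity. }
  apply (split_mono_cancel P _ _ _ HP), (eq_trans (y := idm _)).
  - unfold P; rewrite (act_pentagon HA), !comp_assoc, (comp_cancel_l _ _ _ Halpha),
      (comp_cancel_l _ _ _ (asc_iso2 HA _ _ _)), Hasc.
    reflexivity.
  - unfold P; rewrite !comp_assoc, (comp_cancel_l _ _ _ (asc_iso2 HA _ _ _)), (asc_iso2 HA).
    reflexivity.
Qed.

Lemma act_unit_hom_inj {x y : ob C} (f g : hom x y) :
  act_hom A (idm (unit_ob MM)) f = act_hom A (idm (unit_ob MM)) g -> f = g.
Proof.
  intro E. apply (split_epi_cancel (lam A x) (lam_inv A x)); [exact (lam_iso2 HA x)|].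
  rewrite <- !(lam_nat HA), E. reflexivity.
Qed.

Lemma Rx_tambara (x : ob C) : IsTambara (Rx A x).
Proof.
  constructor; cbn; intros.
  - rewrite (act_id HA), comp_id_l, comp_id_r. reflexivity.
  - rewrite act_hom_comp_l, !comp_assoc. reflexivity.
  - rewrite !act_hom_comp_r, !comp_assoc, asc_inv_nat. reflexivity.
  - rewrite comp_id_l, (act_id HA), comp_id_r, <- comp_assoc, act_hom_interchange,
      !comp_assoc, asc_inv_nat_l.
    reflexivity.
  - rewrite !comp_assoc, asc_inv_unit_l, (lam_nat HA), (comp_cancel_l _ _ _ (lam_iso2 HA _)).
    reflexivity.
  - rewrite act_hom_comp_r, !comp_assoc, asc_inv_pentagon,
      <- (comp_assoc (act_hom A (idm m) (act_hom A (idm n) p))), asc_inv_nat, (tens_id MM),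
      comp_assoc, (comp_cancel_l _ _ _ (asc_iso1 HA _ _ _)).
    reflexivity.
Qed.

Lemma Rf_tambHom (x y : ob C) (f : hom x y) :
  IsTambHom (Rx A x) (Rx A y) (fun c n => @Rf _ _ _ A _ _ f c n).
Proof.
  unfold Rf; split; cbn; intros.
  - rewrite !comp_assoc, act_hom_interchange. reflexivity.
  - rewrite act_hom_comp_r, !comp_assoc, asc_inv_nat, (tens_id MM). reflexivity.
Qed.

Lemma Rf_id (x : ob C) c n (h : pob (Rx A x) c n) : Rf A (idm x) h = h.
Proof. unfold Rf. rewrite (act_id HA), comp_id_r. reflexivity. Qed.

Lemma Rf_comp (x y z : ob C) (f : hom x y) (g : hom y z) c n (h : pob (Rx A x) c n) :
  Rf A (f ;; g) h = Rf A g (Rf A f h).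
Proof. unfold Rf. rewrite act_hom_comp_r, comp_assoc. reflexivity. Qed.

Lemma Rf_faithful (x y : ob C) (f g : hom x y) :
  (forall c n (h : pob (Rx A x) c n), Rf A f h = Rf A g h) -> f = g.
Proof.
  intro E. apply act_unit_hom_inj, (split_epi_cancel (lam_inv A x) (lam A x)).
  - exact (lam_iso1 HA x).
  - exact (E x (unit_ob MM) (lam_inv A x)).
Qed.

Lemma Rx_idm_from_lam_inv (x : ob C) (n : ob M) :
  idm (act A n x) = dimap (Rx A x) (idm _) (rhoM MM n) (st (Rx A x) n (lam_inv A x)).
Proof.
  cbn. rewrite comp_id_l, comp_assoc, asc_inv_unit_r, <- act_hom_comp_r, (lam_iso2 HA),
    (act_id HA).
  reflexivity.
Qed.

Section RxFull.
Context {x y : ob C} {th : forall c n, pob (Rx A x) c n -> pob (Rx A y) c n}.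
Hypothesis Hth : IsTambHom (Rx A x) (Rx A y) th.

Lemma Rx_tambHom_postcomp c n (h : pob (Rx A x) c n) : th c n h = h ;; th _ n (idm _).
Proof.
  transitivity (th c n (dimap (Rx A x) h (idm n) (idm _))).
  - cbn. rewrite (act_id HA), !comp_id_r. reflexivity.
  - rewrite (proj1 Hth). cbn. rewrite (act_id HA), comp_id_r. reflexivity.
Qed.

Lemma Rx_tambHom_eq_Rf c n (h : pob (Rx A x) c n) :
  th c n h = Rf A (th x (unit_ob MM) (lam_inv A x) ;; lam A y) h.
Proof.
  destruct Hth as [Hdimap Hst]; cbn [act selfAct] in Hst.
  rewrite Rx_tambHom_postcomp, Rx_idm_from_lam_inv, Hdimap, Hst. cbn; unfold Rf.
  rewrite comp_id_l, comp_assoc, asc_inv_unit_r, act_hom_comp_r.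
  reflexivity.
Qed.

End RxFull.

Lemma Rf_full (x y : ob C) (th : forall c n, pob (Rx A x) c n -> pob (Rx A y) c n) :
  IsTambHom (Rx A x) (Rx A y) th ->
  exists f : hom x y, forall c n (h : pob (Rx A x) c n), th c n h = Rf A f h.
Proof.
  intro Hth. exists (th x (unit_ob MM) (lam_inv A x) ;; lam A y).
  exact (Rx_tambHom_eq_Rf Hth).
Qed.

Lemma Lx_tambara (x : ob C) : IsTambara (Lx A x).
Proof.
  constructor; cbn; intros.
  - rewrite (act_id HA), comp_id_l, comp_id_r. reflexivity.
  - rewrite act_hom_comp_l, !comp_assoc. reflexivity.
  - rewrite !act_hom_comp_r, <- !comp_assoc, (asc_nat HA). reflexivity.
  - rewrite (act_id HA), comp_id_l, comp_id_r, <- comp_assoc, asc_nat_l, !comp_assoc,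
      act_hom_interchange.
    reflexivity.
  - rewrite !comp_assoc, (lam_nat HA), <- (comp_assoc (asc A _ _ _)), (act_unit_l HA),
      <- comp_assoc, <- act_hom_comp_l, (lamM_iso2 MM), (act_id HA), comp_id_l.
    reflexivity.
  - rewrite act_hom_comp_r, <- !comp_assoc, <- (act_pentagon HA), !comp_assoc, asc_inv_nat,
      (comp_cancel_l _ _ _ (asc_iso1 HA _ _ _)), (tens_id MM).
    reflexivity.
Qed.

Lemma Lf_tambHom (x y : ob C) (f : hom x y) :
  IsTambHom (Lx A y) (Lx A x) (fun n c => @Lf _ _ _ A _ _ f n c).
Proof.
  unfold Lf; split; cbn; intros.
  - rewrite <- !comp_assoc, act_hom_interchange. reflexivity.
  - rewrite act_hom_comp_r, <- (tens_id MM), <- !comp_assoc, (asc_nat HA). reflexivity.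
Qed.

Lemma Lf_id (x : ob C) n c (h : pob (Lx A x) n c) : Lf A (idm x) h = h.
Proof. unfold Lf. rewrite (act_id HA), comp_id_l. reflexivity. Qed.

Lemma Lf_comp (x y z : ob C) (f : hom x y) (g : hom y z) n c (h : pob (Lx A z) n c) :
  Lf A (f ;; g) h = Lf A f (Lf A g h).
Proof. unfold Lf. rewrite act_hom_comp_r, comp_assoc. reflexivity. Qed.

Lemma Lf_faithful (x y : ob C) (f g : hom x y) :
  (forall n c (h : pob (Lx A y) n c), Lf A f h = Lf A g h) -> f = g.
Proof.
  intro E. apply act_unit_hom_inj, (split_mono_cancel (lam A y) (lam_inv A y)).
  - exact (lam_iso1 HA y).
  - exact (E (unit_ob MM) y (lam A y)).
Qed.

Lemma Lx_idm_from_lam (y : ob C) (n : ob M) :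
  idm (act A n y) = dimap (Lx A y) (rhoM_inv MM n) (idm _) (st (Lx A y) n (lam A y)).
Proof.
  cbn. rewrite comp_id_r, (act_unit_r HA), <- act_hom_comp_l, (rhoM_iso2 MM), (act_id HA).
  reflexivity.
Qed.

Section LxFull.
Context {x y : ob C} {th : forall n c, pob (Lx A y) n c -> pob (Lx A x) n c}.
Hypothesis Hth : IsTambHom (Lx A y) (Lx A x) th.

Lemma Lx_tambHom_precomp n c (h : pob (Lx A y) n c) : th n c h = th n _ (idm _) ;; h.
Proof.
  transitivity (th n c (dimap (Lx A y) (idm n) h (idm _))).
  - cbn. rewrite (act_id HA), !comp_id_l. reflexivity.
  - rewrite (proj1 Hth). cbn. rewrite (act_id HA), comp_id_l. reflexivity.
Qed.

Lemma Lx_tambHom_eq_Lf n c (h : pob (Lx A y) n c) :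
  th n c h = Lf A (lam_inv A x ;; th (unit_ob MM) y (lam A y)) h.
Proof.
  destruct Hth as [Hdimap Hst]; cbn [act selfAct] in Hst.
  rewrite Lx_tambHom_precomp, Lx_idm_from_lam, Hdimap, Hst. cbn; unfold Lf.
  rewrite comp_id_r, asc_unit_r, <- !comp_assoc, <- act_hom_comp_l, (rhoM_iso2 MM),
    (act_id HA), comp_id_l, act_hom_comp_r.
  reflexivity.
Qed.

End LxFull.

Lemma Lf_full (x y : ob C) (th : forall n c, pob (Lx A y) n c -> pob (Lx A x) n c) :
  IsTambHom (Lx A y) (Lx A x) th ->
  exists f : hom x y, forall n c (h : pob (Lx A y) n c), th n c h = Lf A f h.
Proof.
  intro Hth. exists (lam_inv A x ;; th (unit_ob MM) y (lam A y)).
  exact (Lx_tambHom_eq_Lf Hth).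
Qed.

End ActegoryFacts.

Theorem mainTheorem7 (M : Category) (MM : Monoidal M) (C : Category)
    (A : Actegory MM C) :
  (* R : C -> Tamb_{C,M} is a well-defined functor ... *)
  (forall x, IsTambara (Rx A x)) /\
  (forall x y (f : hom x y), IsTambHom (Rx A x) (Rx A y) (fun c n => @Rf _ _ _ A _ _ f c n)) /\
  (forall x c n (h : pob (Rx A x) c n), Rf A (idm x) h = h) /\
  (forall x y z (f : hom x y) (g : hom y z) c n (h : pob (Rx A x) c n),
      Rf A (f ;; g) h = Rf A g (Rf A f h)) /\
  (* ... which is faithful ... *)
  (forall x y (f g : hom x y),
      (forall c n (h : pob (Rx A x) c n), Rf A f h = Rf A g h) -> f = g) /\
  (* ... and full; *)
  (forall x y (th : forall c n, pob (Rx A x) c n -> pob (Rx A y) c n),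
      IsTambHom (Rx A x) (Rx A y) th ->
      exists f : hom x y, forall c n (h : pob (Rx A x) c n), th c n h = Rf A f h) /\
  (* L : C^op -> Tamb_{M,C} is a well-defined functor ... *)
  (forall x, IsTambara (Lx A x)) /\
  (forall x y (f : hom x y), IsTambHom (Lx A y) (Lx A x) (fun n c => @Lf _ _ _ A _ _ f n c)) /\
  (forall x n c (h : pob (Lx A x) n c), Lf A (idm x) h = h) /\
  (forall x y z (f : hom x y) (g : hom y z) n c (h : pob (Lx A z) n c),
      Lf A (f ;; g) h = Lf A f (Lf A g h)) /\
  (* ... which is faithful ... *)
  (forall x y (f g : hom x y),
      (forall n c (h : pob (Lx A y) n c), Lf A f h = Lf A g h) -> f = g) /\
  (* ... and full. *)
  (forall x y (th : forall n c, pob (Lx A y) n c -> pob (Lx A x) n c),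
      IsTambHom (Lx A y) (Lx A x) th ->
      exists f : hom x y, forall n c (h : pob (Lx A y) n c), th n c h = Lf A f h).
Proof.
  pose proof (adata_ax A) as HA.
  exact (conj (Rx_tambara HA) (conj (Rf_tambHom HA) (conj (Rf_id HA) (conj (Rf_comp HA)
        (conj (Rf_faithful HA) (conj (Rf_full HA)
        (conj (Lx_tambara HA) (conj (Lf_tambHom HA) (conj (Lf_id HA) (conj (Lf_comp HA)
        (conj (Lf_faithful HA) (Lf_full HA)))))))))))).
Qed.
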